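(* Let $I$ be an isotopy in $\mathrm{Homeo}_0(\mathbb{A})$ from the identity to a homeomorphism $f$. Then $\rho_{\mathrm{ann}}(I)$ is an interval of $\overline{\mathbb{R}}$.
   Context: $\mathbb{T}^1=\mathbb{R}/\mathbb{Z}$, $\mathbb{A}=\mathbb{T}^1\times\mathbb{R}$ is the open annulus with universal covering $\pi:\mathbb{R}^2\to\mathbb{A}$ and $p_1:\mathbb{R}^2\to\mathbb{R}$ the first coordinate projection. $\mathrm{Homeo}_0(\mathbb{A})$ is the set of homeomorphisms of $\mathbb{A}$ isotopic to the identity. For an isotopy $I=(f_t)_{t\in[0,1]}$ from the identity to $f=f_1$, let $(\tilde f_t)$ be its lift to $\mathbb{R}^2$ with $\tilde f_0=\mathrm{Id}$, and $\tilde f=\tilde f_1$. For $z\in\mathbb{A}$ and $n\ge1$, $\rho_n(z)=\frac1n(p_1(\tilde f^n(\tilde z))-p_1(\tilde z))$ with $\tilde z\in\pi^{-1}(z)$. For a compact $K\subset\mathbb{A}$, $\rho_K(I)=\bigcap_{m\ge1}\mathrm{Cl}\big(\bigcup_{n\ge m}\{\rho_n(z): z\in K,\ f^n(z)\in K\}\big)$, closure in $\overline{\mathbb{R}}=\mathbb{R}\cup\{\pm\infty\}$, and $\rho_{\mathrm{ann}}(I)=\mathrm{Cl}\big(\bigcup_K\rho_K(I)\big)$, union over all compact $K\subset\mathbb{A}$. *)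

(* Defs.v *)
From Stdlib Require Import Reals Lra List ZArith.
Open Scope R_scope.

(* Points of R^2 (universal cover of the annulus A = T^1 x R). *)
Definition R2 : Type := (R * R)%type.

(* sup-distance on R^2 (induces the usual topology) *)
Definition dist2 (p q : R2) : R :=
  Rmax (Rabs (fst p - fst q)) (Rabs (snd p - snd q)).

Definition cont2 (g : R2 -> R2) : Prop :=
  forall p eps, 0 < eps -> exists d, 0 < d /\
    forall q, dist2 p q < d -> dist2 (g p) (g q) < eps.

Definition open2 (U : R2 -> Prop) : Prop :=
  forall p, U p -> exists d, 0 < d /\ forall q, dist2 p q < d -> U q.

Definition compact2 (K : R2 -> Prop) : Prop :=
  forall (I : Type) (U : I -> R2 -> Prop),
    (forall i, open2 (U i)) ->
    (forall p, K p -> exists i, U i p) ->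
    exists l : list I, forall p, K p -> exists i, In i l /\ U i p.

(* F is the lift (tilde f_t)_{t in [0,1]}, with tilde f_0 = Id, of an isotopy
   I = (f_t) in Homeo_0(A) from the identity: jointly continuous in (t,z),
   each F t a homeomorphism of R^2, and F t commutes with the deck
   translation T(x,y) = (x+1,y). *)
Definition isotopy_lift (F : R -> R2 -> R2) : Prop :=
  (forall t p eps, 0 <= t <= 1 -> 0 < eps -> exists d, 0 < d /\
     forall s q, 0 <= s <= 1 -> Rabs (s - t) < d -> dist2 p q < d ->
       dist2 (F t p) (F s q) < eps)
  /\ (forall p, F 0 p = p)
  /\ (forall t, 0 <= t <= 1 -> exists g : R2 -> R2,
        cont2 g /\ (forall p, g (F t p) = p) /\ (forall p, F t (g p) = p))
  /\ (forall t x y, 0 <= t <= 1 ->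
        F t (x + 1, y) = (fst (F t (x, y)) + 1, snd (F t (x, y)))).

Definition fiter (F : R -> R2 -> R2) (n : nat) (p : R2) : R2 :=
  Nat.iter n (F 1) p.

(* rho_n(z) computed at a lift p of z *)
Definition rho_n (F : R -> R2 -> R2) (n : nat) (p : R2) : R :=
  (fst (fiter F n p) - fst p) / INR n.

(* p lies in pi^{-1}(pi(K)) *)
Definition in_piK (K : R2 -> Prop) (p : R2) : Prop :=
  exists k : Z, K (fst p - IZR k, snd p).

Inductive ER : Type := Fin : R -> ER | PInf : ER | MInf : ER.

Definition ER_le (a b : ER) : Prop :=
  match a, b with
  | MInf, _ => True
  | _, PInf => True
  | Fin x, Fin y => x <= y
  | _, _ => False
  end.

Definition ER_nbhd (x : ER) (r : R) (y : ER) : Prop :=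
  match x with
  | Fin a => exists s, y = Fin s /\ Rabs (s - a) < r
  | PInf => y = PInf \/ exists s, y = Fin s /\ r < s
  | MInf => y = MInf \/ exists s, y = Fin s /\ s < r
  end.

Definition ER_cl (S : ER -> Prop) (x : ER) : Prop :=
  forall r, (match x with Fin _ => 0 < r | _ => True end) ->
    exists y, S y /\ ER_nbhd x r y.

(* rho_K(I) = bigcap_{m>=1} Cl( bigcup_{n>=m} {rho_n(z) : z in K, f^n(z) in K} ),
   with the compact K of A given as pi(K~) for a compact K~ of R^2. *)
Definition rho_K (F : R -> R2 -> R2) (K : R2 -> Prop) (x : ER) : Prop :=
  forall m : nat, (1 <= m)%nat ->
    ER_cl (fun y => exists (n : nat) (p : R2),
             (m <= n)%nat /\ in_piK K p /\ in_piK K (fiter F n p) /\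
             y = Fin (rho_n F n p)) x.

Definition rho_ann (F : R -> R2 -> R2) (x : ER) : Prop :=
  ER_cl (fun y => exists K, compact2 K /\ rho_K F K y) x.

Definition ER_interval (S : ER -> Prop) : Prop :=
  forall a b c, S a -> S c -> ER_le a b -> ER_le b c -> S b.

(* Main.v *)
Require Import Defs.
From Stdlib Require Import Reals Lra Lia List ZArith Classical ClassicalEpsilon.
From Coquelicot Require Import Coquelicot.
Open Scope R_scope.

(* Let h be the time-one map on the plane, D_n the horizontal displacement of its
   n-th iterate, and b a number strictly between two elements of the rotation set.
   Then for some strip |y| <= M there are arbitrarily long orbits from the strip to
   itself with D_n <= b n, and others with D_n >= b n.

   If both kinds occur for the same n, at z and w, join z to w by a segment s of
   horizontal extent less than 1.  As s is disjoint from s + (1, 0), so is h^n(s)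
   from h^n(s) + (1, 0).  A path in a half plane {y >= M} with end points on the
   boundary line at distance more than 1 meets its translate by (1, 0), so h^n(s)
   must visit the strip near every abscissa between those of h^n(z) and h^n(w);
   this yields points u of s with D_n(u) = b n up to a bounded error.

   It remains to compare different n.  Passing to h^2 we may suppose that the ends
   are preserved.  If neither h^j nor h^(j+1) maps a point of the strip to the
   strip, each of them pushes a half plane bounded by the strip strictly off the
   strip; the directions agree since h^(j(j+1)) is a power of both, and no iterate
   h^l with l >= j^2 brings the strip back to itself.  So return times have gaps at
   most 2, and both kinds occur at times differing by at most 2. *)

(** * Paths in the plane and their translates *)

Definition box (x y r : R) (u v : R) : Prop := Rabs (u - x) < r /\ Rabs (v - y) < r.

(** Compactness is applied to half of the local radii: a box of radius [d <= delta] around a point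
    within [delta] of a centre lies in the box of radius [2 * delta] around that centre. The
    hereditary property [P] is left arbitrary, to serve both sign conditions and open covers. *)
Lemma lebesgue_number (a b c e : R) (P : (R -> R -> Prop) -> Prop) :
  (forall A B : R -> R -> Prop, (forall u v, A u v -> B u v) -> P B -> P A) ->
  (forall x y, a <= x <= b -> c <= y <= e -> exists r, 0 < r /\ P (box x y r)) ->
  exists d, 0 < d /\ forall x y, a <= x <= b -> c <= y <= e -> P (box x y d).
Proof.
  intros Hmono Hloc.
  assert (Hr : forall z : R * R, exists r : posreal,
             a <= fst z <= b -> c <= snd z <= e -> P (box (fst z) (snd z) (2 * r))).
  { intros [x y]; simpl.
    destruct (classic (a <= x <= b /\ c <= y <= e)) as [[Hx Hy]|Hn].
    - destruct (Hloc x y Hx Hy) as [r [Hr HP]].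
      assert (Hr2 : 0 < r / 2) by lra.
      exists (mkposreal _ Hr2); intros _ _; simpl.
      replace (2 * (r / 2)) with r by field; exact HP.
    - exists (mkposreal 1 Rlt_0_1); tauto. }
  set (delta := fun x y => proj1_sig (constructive_indefinite_description _ (Hr (x, y)))).
  destruct (compactness_value_2d a b c e delta) as [d Hd].
  exists d; split; [apply cond_pos|].
  intros x y Hx Hy.
  destruct (NNPP _ (Hd x y Hx Hy)) as [u [v [Hu [Hv [Hxu [Hyv Hdd]]]]]].
  assert (HP : P (box u v (2 * delta u v))).
  { unfold delta; destruct (constructive_indefinite_description _ (Hr (u, v))) as [r H].
    apply H; assumption. }
  revert HP; apply Hmono; intros s t [Hs Ht].
  unfold box; split.
  - replace (s - u) with ((s - x) + (x - u)) by ring.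
    eapply Rle_lt_trans; [apply Rabs_triang|]; lra.
  - replace (t - v) with ((t - y) + (y - v)) by ring.
    eapply Rle_lt_trans; [apply Rabs_triang|]; lra.
Qed.

Definition same_sign (f : R -> R -> R) (A : R -> R -> Prop) : Prop :=
  (forall u v, A u v -> 0 < f u v) \/ (forall u v, A u v -> f u v < 0).

Lemma continuous_same_sign (f : R -> R -> R) (x y : R) :
  continuity_2d_pt f x y -> f x y <> 0 ->
  exists r, 0 < r /\ same_sign f (box x y r).
Proof.
  intros Hc Hn.
  assert (Hp : 0 < Rabs (f x y)) by (apply Rabs_pos_lt; exact Hn).
  destruct (Hc (mkposreal _ Hp)) as [r Hr]; simpl in Hr.
  exists r; split; [apply cond_pos|].
  destruct (Rlt_dec 0 (f x y)) as [Hs|Hs]; [left|right]; intros u v [Hu Hv];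
    specialize (Hr u v Hu Hv).
  - rewrite (Rabs_right (f x y)) in Hr by lra. apply Rabs_def2 in Hr; lra.
  - rewrite (Rabs_left (f x y)) in Hr by lra. apply Rabs_def2 in Hr; lra.
Qed.

(** Zero counts as nonnegative: on three sides of the square [Q] will only be known to be [>= 0],
    and the indicator must be constant there. *)
Definition nonneg_ind (x : R) : Z := if Rle_dec 0 x then 1%Z else 0%Z.

Lemma nonneg_ind_1 x : 0 <= x -> nonneg_ind x = 1%Z.
Proof. unfold nonneg_ind; destruct (Rle_dec 0 x); intros; [reflexivity|lra]. Qed.

Lemma nonneg_ind_0 x : x < 0 -> nonneg_ind x = 0%Z.
Proof. unfold nonneg_ind; destruct (Rle_dec 0 x); intros; [lra|reflexivity]. Qed.

Fixpoint Zsum (f : nat -> Z) (n : nat) : Z :=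
  match n with O => 0%Z | S k => (Zsum f k + f k)%Z end.

(* Along a discretised path, [cross] counts the algebraic number of crossings of
   the positive half axis [P > 0, Q = 0].  Around a cell on which [P] or [Q] keeps
   its sign the count is zero, hence it is zero around the whole square. *)
Section WindingNumber.

Variables P Q : nat -> nat -> R.
Variable n : nat.

Let h i j := nonneg_ind (Q i j).
Let c i j := nonneg_ind (P i j).

Definition cross (i j i' j' : nat) : Z := (c i j * (h i' j' - h i j))%Z.

Definition cell (i j i' j' : nat) : Prop :=
  (i' = i \/ i' = S i) /\ (j' = j \/ j' = S j).

Hypothesis Hcell : forall i j, (i < n)%nat -> (j < n)%nat ->
  (forall i' j', cell i j i' j' -> 0 < Q i' j') \/
  (forall i' j', cell i j i' j' -> Q i' j' < 0) \/
  (forall i' j', cell i j i' j' -> 0 < P i' j') \/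
  (forall i' j', cell i j i' j' -> P i' j' < 0).

(** Where [Q] keeps its sign, [h] is constant and every term vanishes; where [P] does, [c] is
    constant and both sides telescope to the same difference of [h]. *)
Lemma cross_cell i j : (i < n)%nat -> (j < n)%nat ->
  (cross i j (S i) j + cross (S i) j (S i) (S j)
   = cross i j i (S j) + cross i (S j) (S i) (S j))%Z.
Proof.
  intros Hi Hj; unfold cross, c, h.
  assert (H00 : cell i j i j) by (unfold cell; auto).
  assert (H10 : cell i j (S i) j) by (unfold cell; auto).
  assert (H01 : cell i j i (S j)) by (unfold cell; auto).
  assert (H11 : cell i j (S i) (S j)) by (unfold cell; auto).
  destruct (Hcell i j Hi Hj) as [H|[H|[H|H]]];
    pose proof (H _ _ H00); pose proof (H _ _ H10);
    pose proof (H _ _ H01); pose proof (H _ _ H11).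
  - rewrite !(nonneg_ind_1 (Q _ _)) by lra; lia.
  - rewrite !(nonneg_ind_0 (Q _ _)) by lra; lia.
  - rewrite !(nonneg_ind_1 (P _ _)) by lra; lia.
  - rewrite !(nonneg_ind_0 (P _ _)) by lra; lia.
Qed.

Lemma cross_rows j k : (j < n)%nat -> (k <= n)%nat ->
  (Zsum (fun i => cross i j (S i) j) k + cross k j k (S j)
   = cross 0 j 0 (S j) + Zsum (fun i => cross i (S j) (S i) (S j)) k)%Z.
Proof.
  intros Hj; induction k as [|k IH]; intros Hk; simpl; [lia|].
  pose proof (cross_cell k j ltac:(lia) Hj). specialize (IH ltac:(lia)). lia.
Qed.

Hypothesis Hleft : forall j, (j <= n)%nat -> 0 <= Q 0 j.
Hypothesis Hright : forall j, (j <= n)%nat -> 0 <= Q n j.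
Hypothesis Hbottom : forall i, (i <= n)%nat -> 0 <= Q i 0.
Hypothesis Htop : forall i, (i <= n)%nat -> Q i n <= 0.

(** Rows are compared from the bottom up: [h] is 1 on the bottom, left and right sides, so neither
    the first row nor the lateral edges contribute. *)
Lemma cross_row_zero j : (j <= n)%nat ->
  Zsum (fun i => cross i j (S i) j) n = 0%Z.
Proof.
  induction j as [|j IH]; intros Hj.
  - assert (H : forall k, (k <= n)%nat -> Zsum (fun i => cross i 0 (S i) 0) k = 0%Z).
    { induction k as [|k IHk]; intros Hk; simpl; [reflexivity|].
      rewrite IHk by lia. unfold cross, h.
      rewrite !nonneg_ind_1 by (apply Hbottom; lia). lia. }
    apply H; lia.
  - pose proof (cross_rows j n ltac:(lia) ltac:(lia)) as H.
    rewrite IH in H by lia. unfold cross at 1 2, h in H.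
    rewrite !(nonneg_ind_1 (Q 0 _)) in H by (apply Hleft; lia).
    rewrite !(nonneg_ind_1 (Q n _)) in H by (apply Hright; lia). lia.
Qed.

(** Summation by parts. As [Q <= 0] on the top side, [h = 1] at a node forces [Q = 0] there; then
    [P] keeps its sign on the cell below, [c] does not change, and the correction term vanishes. *)
Lemma cross_top k : (0 < n)%nat -> (k <= n)%nat ->
  Zsum (fun i => cross i n (S i) n) k = (c k n * h k n - c 0 n * h 0 n)%Z.
Proof.
  intros Hn; induction k as [|k IH]; intros Hk; simpl; [lia|].
  rewrite IH by lia. unfold cross.
  enough (h (S k) n * (c (S k) n - c k n) = 0)%Z by lia.
  assert (H0 : cell k (n - 1) k n) by (unfold cell; lia).
  assert (H1 : cell k (n - 1) (S k) n) by (unfold cell; lia).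
  pose proof (Htop (S k) ltac:(lia)).
  destruct (Hcell k (n - 1) ltac:(lia) ltac:(lia)) as [H'|[H'|[H'|H']]];
    pose proof (H' _ _ H0); pose proof (H' _ _ H1); unfold c, h.
  - lra.
  - rewrite (nonneg_ind_0 (Q (S k) n)) by lra; lia.
  - rewrite !(nonneg_ind_1 (P _ _)) by lra; lia.
  - rewrite !(nonneg_ind_0 (P _ _)) by lra; lia.
Qed.

(** The corner values make the sum along the top row equal to -1, whereas every row has sum 0. *)
Lemma winding_contradiction : (0 < n)%nat -> 0 < P 0 n -> P n n < 0 -> False.
Proof.
  intros Hn H0 H1.
  pose proof (cross_top n Hn ltac:(lia)) as H.
  rewrite cross_row_zero in H by lia. unfold c, h in H.
  rewrite (nonneg_ind_0 (P n n)), (nonneg_ind_1 (P 0 n)),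
    (nonneg_ind_1 (Q 0 n)) in H by (try apply Hleft; lra || lia).
  lia.
Qed.

End WindingNumber.

(** Without a common zero, [P] or [Q] keeps its sign near each point, and a grid finer than the
    Lebesgue number satisfies the cell hypothesis of the winding argument. *)
Lemma square_common_zero (P Q : R -> R -> R) :
  (forall s t, continuity_2d_pt P s t) -> (forall s t, continuity_2d_pt Q s t) ->
  (forall t, 0 <= t <= 1 -> 0 <= Q 0 t) ->
  (forall t, 0 <= t <= 1 -> 0 <= Q 1 t) ->
  (forall s, 0 <= s <= 1 -> 0 <= Q s 0) ->
  (forall s, 0 <= s <= 1 -> Q s 1 <= 0) ->
  0 < P 0 1 -> P 1 1 < 0 ->
  exists s t, 0 <= s <= 1 /\ 0 <= t <= 1 /\ P s t = 0 /\ Q s t = 0.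
Proof.
  intros HP HQ Hl Hr Hb Ht H0 H1.
  apply NNPP; intros Hno.
  destruct (lebesgue_number 0 1 0 1 (fun A => same_sign Q A \/ same_sign P A))
    as [d [Hd HL]].
  { intros A B HAB [[H|H]|[H|H]]; [left; left|left; right|right; left|right; right];
      intros u v Huv; apply H, HAB, Huv. }
  { intros x y Hx Hy.
    destruct (Req_dec (Q x y) 0) as [HQ0|HQ0].
    - destruct (Req_dec (P x y) 0) as [HP0|HP0].
      + exfalso; apply Hno; exists x, y; auto.
      + destruct (continuous_same_sign P x y (HP x y) HP0) as [r [? ?]]; eauto.
    - destruct (continuous_same_sign Q x y (HQ x y) HQ0) as [r [? ?]]; eauto. }
  destruct (archimed_cor1 d Hd) as [n [Hn Hn0]].
  assert (HnR : 0 < INR n) by (apply lt_0_INR; lia).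
  assert (Hin : forall i, (i <= n)%nat -> 0 <= INR i / INR n <= 1).
  { intros i Hi. apply le_INR in Hi. pose proof (pos_INR i). split.
    - apply Rdiv_le_0_compat; lra.
    - apply Rmult_le_reg_r with (INR n); [lra|].
      unfold Rdiv; rewrite Rmult_assoc, Rinv_l by lra; lra. }
  assert (E0 : INR 0 / INR n = 0) by (simpl; field; lra).
  assert (En : INR n / INR n = 1) by (field; lra).
  assert (Hstep : forall i i', (i' = i \/ i' = S i) -> Rabs (INR i' / INR n - INR i / INR n) < d).
  { intros i i' [->| ->].
    - rewrite Rminus_diag, Rabs_R0; exact Hd.
    - rewrite S_INR. replace ((INR i + 1) / INR n - INR i / INR n) with (/ INR n) by (field; lra).
      rewrite Rabs_right; [exact Hn|]. apply Rle_ge, Rlt_le, Rinv_0_lt_compat, HnR. }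
  apply (winding_contradiction (fun i j => P (INR i / INR n) (INR j / INR n))
           (fun i j => Q (INR i / INR n) (INR j / INR n)) n);
    rewrite ?E0, ?En; auto.
  - intros i j Hi Hj.
    assert (Hc : forall i' j', cell i j i' j' ->
               box (INR i / INR n) (INR j / INR n) d (INR i' / INR n) (INR j' / INR n)).
    { intros i' j' [? ?]; split; apply Hstep; assumption. }
    destruct (HL (INR i / INR n) (INR j / INR n) (Hin i ltac:(lia)) (Hin j ltac:(lia)))
      as [[H|H]|[H|H]]; [left|right; left|right; right; left|right; right; right];
      intros i' j' Hij; apply H, Hc, Hij.
Qed.

(* Hopf's argument: [(s, t) |-> g t - g s - (1, 0)] on the triangle [s <= t], here
   parametrised by the square, winds once around the origin along the boundary. *)
Lemma half_plane_chord (X Y : R -> R) (a b : R) :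
  continuity X -> continuity Y -> a <= b ->
  (forall t, a <= t <= b -> Y a <= Y t) -> Y b = Y a -> X a + 1 < X b ->
  exists s t, a <= s <= b /\ a <= t <= b /\ X t = X s + 1 /\ Y t = Y s.
Proof.
  intros HX HY Hab Hup HYb HXb.
  (* The side [s = 0] becomes [sig = a], the side [s = 1] the diagonal, the side [t = 0] collapses
     to the vertex [(a, a)], and [t = 1] becomes [tau = b]. *)
  set (tau := fun _ t : R => a + (b - a) * t).
  set (sig := fun s t : R => a + (b - a) * (s * t)).
  assert (Htau : forall s t, continuity_2d_pt tau s t).
  { intros; unfold tau.
    repeat first [apply continuity_2d_pt_plus | apply continuity_2d_pt_mult
      | apply continuity_2d_pt_const | apply continuity_2d_pt_id2]. }
  assert (Hsig : forall s t, continuity_2d_pt sig s t).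
  { intros; unfold sig.
    apply continuity_2d_pt_plus; [apply continuity_2d_pt_const|].
    apply continuity_2d_pt_mult; [apply continuity_2d_pt_const|].
    apply continuity_2d_pt_mult; [apply continuity_2d_pt_id1|apply continuity_2d_pt_id2]. }
  assert (Hin : forall u, 0 <= u <= 1 -> a <= a + (b - a) * u <= b) by (intros; nra).
  destruct (square_common_zero (fun s t => X (tau s t) - X (sig s t) - 1)
              (fun s t => Y (tau s t) - Y (sig s t))) as [s [t [Hs [Ht [HP HQ]]]]].
  - intros s t. repeat apply continuity_2d_pt_minus;
      try apply continuity_2d_pt_const; apply continuity_1d_2d_pt_comp; auto.
  - intros s t. apply continuity_2d_pt_minus; apply continuity_1d_2d_pt_comp; auto.
  - intros t Ht; unfold tau, sig.
    replace (a + (b - a) * (0 * t)) with a by ring.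
    specialize (Hup _ (Hin t Ht)); lra.
  - intros t Ht; unfold tau, sig. rewrite Rmult_1_l; lra.
  - intros t Ht; unfold tau, sig. rewrite !Rmult_0_r; lra.
  - intros s Hs; unfold tau, sig. rewrite !Rmult_1_r.
    replace (a + (b - a)) with b by ring.
    specialize (Hup _ (Hin s Hs)); lra.
  - unfold tau, sig. rewrite Rmult_1_r, Rmult_0_l, Rmult_0_r, Rplus_0_r.
    replace (a + (b - a)) with b by ring; lra.
  - unfold tau, sig. rewrite !Rmult_1_r; lra.
  - exists (sig s t), (tau s t); unfold sig, tau in *; repeat split;
      try apply Hin; try nra; lra.
Qed.

(** The first hypothesis says that [P] is closed, so the supremum of its times in [[a, b]] still
    satisfies it. *)
Lemma last_time (P : R -> Prop) (a b : R) :
  (forall t, ~ P t -> exists d, 0 < d /\ forall s, Rabs (s - t) < d -> ~ P s) ->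
  a <= b -> P a ->
  exists t, a <= t <= b /\ P t /\ forall s, t < s <= b -> ~ P s.
Proof.
  intros Hcl Hab Ha.
  destruct (completeness (fun t => a <= t <= b /\ P t)) as [m [Hub Hlub]].
  - exists b; intros t [? _]; lra.
  - exists a; split; [lra|exact Ha].
  - assert (Hm : a <= m <= b).
    { split; [apply Hub; split; [lra|exact Ha]|]. apply Hlub; intros t [? _]; lra. }
    exists m; split; [exact Hm|]; split.
    + apply NNPP; intros Hn. destruct (Hcl m Hn) as [d [Hd HdP]].
      assert (m <= m - d / 2); [|lra].
      apply Hlub; intros t [Ht HPt].
      destruct (Rle_dec t (m - d / 2)) as [|Hlt]; [assumption|exfalso].
      assert (t <= m) by (apply Hub; auto).
      apply (HdP t); [|exact HPt]. apply Rabs_def1; lra.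
    + intros s Hs HPs. assert (s <= m) by (apply Hub; split; [lra|exact HPs]). lra.
Qed.

Lemma first_time (P : R -> Prop) (a b : R) :
  (forall t, ~ P t -> exists d, 0 < d /\ forall s, Rabs (s - t) < d -> ~ P s) ->
  a <= b -> P b ->
  exists t, a <= t <= b /\ P t /\ forall s, a <= s < t -> ~ P s.
Proof.
  intros Hcl Hab Hb.
  destruct (last_time (fun t => P (- t)) (- b) (- a)) as [t [Ht [HP Hl]]].
  - intros t Ht. destruct (Hcl _ Ht) as [d [Hd H]].
    exists d; split; [exact Hd|]. intros s Hs; apply H.
    replace (- s - - t) with (- (s - t)) by ring. rewrite Rabs_Ropp; exact Hs.
  - lra.
  - rewrite Ropp_involutive; exact Hb.
  - exists (- t); split; [lra|]; split; [exact HP|].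
    intros s Hs HPs. apply (Hl (- s)); [lra|]. rewrite Ropp_involutive; exact HPs.
Qed.

Lemma continuity_near (f : R -> R) (t e : R) : continuity f -> 0 < e ->
  exists d, 0 < d /\ forall s, Rabs (s - t) < d -> Rabs (f s - f t) < e.
Proof.
  intros Hf He. destruct (proj1 (continuity_pt_locally f t) (Hf t) (mkposreal e He)) as [d Hd].
  exists d; split; [apply cond_pos|]. exact Hd.
Qed.

Lemma continuous_no_zero_sign (f : R -> R) (a b : R) :
  continuity f -> a <= b -> (forall t, a <= t <= b -> f t <> 0) ->
  0 < f a -> 0 < f b.
Proof.
  intros Hf Hab Hn Ha.
  destruct (Rlt_dec 0 (f b)) as [|Hb]; [assumption|exfalso].
  destruct (IVT_cor f a b Hf Hab) as [z [Hz Hz0]]; [nra|].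
  exact (Hn z Hz Hz0).
Qed.

Lemma continuous_le_right_end (f : R -> R) (a b m : R) :
  continuity f -> a < b -> (forall t, a < t < b -> m <= f t) -> m <= f b.
Proof.
  intros Hf Hab H. apply Rnot_lt_le; intros Hlt.
  destruct (continuity_near f b (m - f b) Hf) as [d [Hd HdP]]; [lra|].
  set (s := Rmax ((a + b) / 2) (b - d / 2)).
  assert (Hs : a < s < b /\ b - d / 2 <= s).
  { unfold s; split; [split|].
    - apply Rlt_le_trans with ((a + b) / 2); [lra|apply Rmax_l].
    - apply Rmax_lub_lt; lra.
    - apply Rmax_r. }
  assert (Hsd : Rabs (s - b) < d) by (apply Rabs_def1; lra).
  pose proof (H s (proj1 Hs)). pose proof (Rabs_def2 _ _ (HdP s Hsd)). lra.
Qed.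

Lemma continuous_le_left_end (f : R -> R) (a b m : R) :
  continuity f -> a < b -> (forall t, a < t < b -> m <= f t) -> m <= f a.
Proof.
  intros Hf Hab H.
  rewrite <- (Ropp_involutive a).
  apply (continuous_le_right_end (fun t => f (- t)) (- b)).
  - apply (continuity_comp Ropp f); [apply derivable_continuous, derivable_opp, derivable_id|exact Hf].
  - lra.
  - intros t Ht; apply H; lra.
Qed.

(** By continuity both end points have height exactly [M], so this is the half plane case for the
    path reflected by [X] to [- X], which exchanges [s] and [t]. *)
Lemma excursion_chord (X Y : R -> R) (M a b : R) :
  continuity X -> continuity Y -> a < b ->
  (forall t, a < t < b -> M < Y t) -> Y a <= M -> Y b <= M -> X b + 1 < X a ->
  exists s t, a <= s <= b /\ a <= t <= b /\ X t = X s + 1 /\ Y t = Y s.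
Proof.
  intros HX HY Hab HM Ha Hb HXab.
  assert (M <= Y a).
  { apply (continuous_le_left_end Y a b M); auto; intros; apply Rlt_le; auto. }
  assert (M <= Y b).
  { apply (continuous_le_right_end Y a b M); auto; intros; apply Rlt_le; auto. }
  destruct (half_plane_chord (fun t => - X t) Y a b) as [s [t [Hs [Ht [E1 E2]]]]].
  - apply (continuity_opp X HX).
  - exact HY.
  - lra.
  - intros t Ht. destruct (Req_dec t a) as [->|]; [lra|].
    destruct (Req_dec t b) as [->|]; [lra|].
    pose proof (HM t ltac:(lra)); lra.
  - lra.
  - lra.
  - exists t, s; repeat split; lra.
Qed.

(** If the window were avoided, the path would start in the strip right of [k2] and end in it left
    of [k1]. Between the last visit to the right part and the next visit to the left part it makes
    an excursion outside the strip, with end points more than 1 apart; such an excursion has a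
    horizontal chord of length 1. *)
Lemma strip_crossing (X Y : R -> R) (M k1 k2 a b : R) :
  continuity X -> continuity Y -> a <= b -> k1 + 1 < k2 ->
  Rabs (Y a) <= M -> Rabs (Y b) <= M -> k1 <= X a -> X b <= k2 ->
  (forall s t, a <= s <= b -> a <= t <= b -> X t = X s + 1 -> Y t <> Y s) ->
  exists t, a <= t <= b /\ Rabs (Y t) <= M /\ k1 <= X t <= k2.
Proof.
  intros HX HY Hab Hk Ya Yb Xa Xb Hfree.
  apply NNPP; intros Hno.
  assert (Hno' : forall t, a <= t <= b -> Rabs (Y t) <= M -> X t < k1 \/ k2 < X t).
  { intros t Ht HYt. apply NNPP; intros Hn. apply Hno; exists t; repeat split; lra. }
  (* The sign [sgn] covers both closed conditions used below: [k2 <= X] with 1, and [X <= k1] with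
     -1. *)
  assert (Hopen : forall (k sgn t : R),
     ~ (Rabs (Y t) <= M /\ k <= sgn * X t) ->
     exists d, 0 < d /\ forall s, Rabs (s - t) < d -> ~ (Rabs (Y s) <= M /\ k <= sgn * X s)).
  { intros k sgn t Hn.
    destruct (Rle_dec (Rabs (Y t)) M) as [HYt|HYt].
    - assert (Hlt : sgn * X t < k) by (apply Rnot_le_lt; intros ?; apply Hn; split; assumption).
      destruct (continuity_near (fun t => sgn * X t) t (k - sgn * X t)) as [d [Hd H]].
      + apply (continuity_scal X sgn HX).
      + lra.
      + exists d; split; [exact Hd|]; intros s Hs [_ Hs2].
        apply H in Hs. apply Rabs_def2 in Hs; lra.
    - destruct (continuity_near Y t (Rabs (Y t) - M)) as [d [Hd H]]; [exact HY|lra|].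
      exists d; split; [exact Hd|]; intros s Hs [Hs2 _].
      apply H in Hs. rewrite Rabs_minus_sym in Hs.
      pose proof (Rabs_triang_inv (Y t) (Y s)). lra. }
  destruct (last_time (fun t => Rabs (Y t) <= M /\ k2 <= 1 * X t) a b (Hopen k2 1) Hab)
    as [t0 [Ht0 [[Y0 X0] Hlast]]].
  { split; [exact Ya|]. destruct (Hno' a ltac:(lra) Ya); lra. }
  destruct (first_time (fun t => Rabs (Y t) <= M /\ - k1 <= -1 * X t) t0 b
              (Hopen (- k1) (-1)) ltac:(lra)) as [t1 [Ht1 [[Y1 X1] Hfirst]]].
  { split; [exact Yb|]. destruct (Hno' b ltac:(lra) Yb); lra. }
  assert (Hlt : t0 < t1).
  { destruct (Req_dec t0 t1) as [E|]; [rewrite <- E in X1|]; lra. }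
  assert (Hout : forall t, t0 < t < t1 -> M < Rabs (Y t)).
  { intros t Ht. apply Rnot_le_lt; intros HYt.
    destruct (Hno' t ltac:(lra) HYt).
    - apply (Hfirst t); [lra|]; split; [exact HYt|lra].
    - apply (Hlast t); [lra|]; split; [exact HYt|lra]. }
  assert (HM : 0 <= M) by (pose proof (Rabs_pos (Y a)); lra).
  assert (HYn : forall t, t0 < t < t1 -> Y t <> 0).
  { intros t Ht E. specialize (Hout t Ht). rewrite E, Rabs_R0 in Hout; lra. }
  assert (HoppY : continuity (fun t => - Y t)) by (apply (continuity_opp Y HY)).
  set (m := (t0 + t1) / 2).
  assert (Hmm : t0 < m < t1) by (unfold m; lra).
  (* The excursion stays on the side of its midpoint; [f] will be [Y] above the strip and [- Y]
     below it. *)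
  assert (Hsame : forall f : R -> R, continuity f -> (forall t, t0 < t < t1 -> f t <> 0) ->
     0 < f m -> forall t, t0 < t < t1 -> 0 < f t).
  { intros f Hf Hfn Hfm t Ht. destruct (Rle_dec m t) as [Hmt|Hmt].
    - apply (continuous_no_zero_sign f m t Hf Hmt); [|exact Hfm]. intros; apply Hfn; lra.
    - apply Rnot_le_lt; intros Hft.
      destruct (IVT_cor f t m Hf) as [z [Hz Hz0]]; [lra|nra|].
      apply (Hfn z); [lra|exact Hz0]. }
  apply Rabs_le_between in Y0. apply Rabs_le_between in Y1.
  destruct (Rlt_dec 0 (Y m)) as [Hpos|Hneg].
  - destruct (excursion_chord X Y M t0 t1) as [s [t [Hs [Ht [E1 E2]]]]]; auto; try lra.
    + intros t Ht. pose proof (Hsame Y HY HYn Hpos t Ht). pose proof (Hout t Ht) as H'.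
      rewrite Rabs_right in H' by lra; exact H'.
    + apply (Hfree s t); auto; lra.
  - pose proof (HYn m Hmm).
    destruct (excursion_chord X (fun t => - Y t) M t0 t1) as [s [t [Hs [Ht [E1 E2]]]]];
      auto; try lra.
    + intros t Ht. assert (0 < - Y t).
      { apply (Hsame (fun t => - Y t)); auto; [|lra].
        intros u Hu Eu; apply (HYn u Hu); lra. }
      pose proof (Hout t Ht) as H'.
      rewrite Rabs_left in H' by lra; exact H'.
    + apply (Hfree s t); auto; lra.
Qed.

(** * Homeomorphisms of the annulus and their ends *)

Lemma dist2_lt (p q : R2) (r : R) :
  dist2 p q < r <-> Rabs (fst p - fst q) < r /\ Rabs (snd p - snd q) < r.
Proof.
  unfold dist2; split.
  - intros H; split; eapply Rle_lt_trans; [apply Rmax_l|exact H|apply Rmax_r|exact H].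
  - intros [? ?]; apply Rmax_lub_lt; assumption.
Qed.

Lemma finite_choice {I J : Type} (Rel : J -> I -> Prop) (L : list J) :
  exists l : list I, forall j, In j L -> (exists i, Rel j i) ->
    exists i, In i l /\ Rel j i.
Proof.
  induction L as [|j L [l Hl]].
  - exists nil; intros j [].
  - destruct (classic (exists i, Rel j i)) as [[i Hi]|Hn].
    + exists (i :: l); intros j' [<-|Hj'] He.
      * exists i; split; [left; reflexivity|exact Hi].
      * destruct (Hl j' Hj' He) as [i' [? ?]]; exists i'; split; [right|]; assumption.
    + exists l; intros j' [<-|Hj'] He; [contradiction|auto].
Qed.

Definition rect (a b c e : R) (p : R2) : Prop := a <= fst p <= b /\ c <= snd p <= e.

Lemma grid_point (a b d : R) : 0 < d -> exists n : nat, forall x, a <= x <= b ->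
  exists k, (k < n)%nat /\ a <= a + INR k * d <= b /\ Rabs (x - (a + INR k * d)) < d.
Proof.
  intros Hd.
  assert (Hfl : forall x, a <= x -> exists k : nat, INR k * d <= x - a < INR k * d + d).
  { intros x Hx.
    destruct (nfloor_ex ((x - a) / d)) as [k [Hk1 Hk2]].
    { apply Rdiv_le_0_compat; lra. }
    assert (E : (x - a) / d * d = x - a) by (field; lra).
    exists k; split.
    - rewrite <- E; apply Rmult_le_compat_r; lra.
    - rewrite <- E. replace (INR k * d + d) with ((INR k + 1) * d) by ring.
      apply Rmult_lt_compat_r; lra. }
  destruct (Rle_dec a b) as [Hab|Hab].
  - destruct (Hfl b Hab) as [n Hn].
    exists (S n); intros x Hx.
    destruct (Hfl x ltac:(lra)) as [k Hk].
    assert (0 <= INR k * d) by (apply Rmult_le_pos; [apply pos_INR|lra]).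
    exists k; repeat split; try lra.
    + assert (INR k * d < INR (S n) * d) by (rewrite S_INR; lra).
      apply INR_lt, Rmult_lt_reg_r with d; assumption.
    + apply Rabs_def1; lra.
  - exists O; intros x Hx; lra.
Qed.

(** Boxes of Lebesgue radius around the nodes of a finite grid cover the rectangle, and each lies in
    one member of the cover. *)
Lemma rect_compact (a b c e : R) : compact2 (rect a b c e).
Proof.
  intros I U HU Hcov.
  destruct (lebesgue_number a b c e (fun A => exists i, forall u v, A u v -> U i (u, v)))
    as [d [Hd HL]].
  { intros A B HAB [i Hi]; exists i; auto. }
  { intros x y Hx Hy. destruct (Hcov (x, y)) as [i Hi]; [split; assumption|].
    destruct (HU i _ Hi) as [r [Hr H]].
    exists r; split; [exact Hr|]; exists i; intros u v [Hu Hv].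
    apply H, dist2_lt; simpl; split; rewrite Rabs_minus_sym; assumption. }
  destruct (grid_point a b d Hd) as [n Hn]. destruct (grid_point c e d Hd) as [m Hm].
  destruct (finite_choice (fun (kl : nat * nat) i => forall u v,
     box (a + INR (fst kl) * d) (c + INR (snd kl) * d) d u v -> U i (u, v))
     (list_prod (seq 0 n) (seq 0 m))) as [l Hl].
  exists l; intros [x y] [Hx Hy]; simpl in Hx, Hy.
  destruct (Hn x Hx) as [k [Hk [Hka Hkb]]]. destruct (Hm y Hy) as [k' [Hk' [Hka' Hkb']]].
  destruct (Hl (k, k')) as [i [Hi HUi]].
  - apply in_prod; apply in_seq; lia.
  - apply (HL (a + INR k * d) (c + INR k' * d) Hka Hka').
  - exists i; split; [exact Hi|]. apply HUi; split; assumption.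
Qed.

Definition strip (M : R) (p : R2) : Prop := Rabs (snd p) <= M.

Definition translate (k : R) (p : R2) : R2 := (fst p + k, snd p).

Lemma open2_cont_bound (g : R2 -> R) (B : R) :
  (forall p e, 0 < e -> exists d, 0 < d /\ forall q, dist2 p q < d -> Rabs (g p - g q) < e) ->
  open2 (fun p => g p < B).
Proof.
  intros Hg p Hp. destruct (Hg p (B - g p)) as [d [Hd H]]; [lra|].
  exists d; split; [exact Hd|]; intros q Hq. apply H in Hq. apply Rabs_def2 in Hq; lra.
Qed.

Lemma cont2_fst_snd (f : R2 -> R2) : cont2 f -> forall p e, 0 < e -> exists d, 0 < d /\
  forall q, dist2 p q < d -> Rabs (fst (f p) - fst (f q)) < e /\ Rabs (snd (f p) - snd (f q)) < e.
Proof.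
  intros Hf p e He. destruct (Hf p e He) as [d [Hd H]].
  exists d; split; [exact Hd|]; intros q Hq; apply dist2_lt; auto.
Qed.

Lemma compact2_bounded (K : R2 -> Prop) (g : R2 -> R) : compact2 K ->
  (forall p e, 0 < e -> exists d, 0 < d /\ forall q, dist2 p q < d -> Rabs (g p - g q) < e) ->
  exists B, forall p, K p -> g p <= B.
Proof.
  intros HK Hg.
  destruct (HK nat (fun n p => g p < INR n)) as [l Hl].
  - intros n; apply open2_cont_bound, Hg.
  - intros p _. destruct (INR_unbounded (g p)) as [n Hn]. exists n; lra.
  - assert (HB : exists B, forall n, In n l -> INR n <= B).
    { clear Hl; induction l as [|n l [B HB]].
      - exists 0; intros n [].
      - exists (Rmax (INR n) B); intros k [<-|Hk]; [apply Rmax_l|].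
        eapply Rle_trans; [apply HB, Hk|apply Rmax_r]. }
    destruct HB as [B HB]. exists B; intros p Hp.
    destruct (Hl p Hp) as [n [Hn Hlt]]. specialize (HB n Hn); lra.
Qed.

Lemma Rabs_Rabs_minus_lt (x y e : R) : Rabs (x - y) < e -> Rabs (Rabs x - Rabs y) < e.
Proof. intros H. eapply Rle_lt_trans; [apply Rabs_triang_inv2|exact H]. Qed.

(** Deck translations do not change the second coordinate. With the converse [in_piK_rect], this
    allows strips to replace compact subsets of the annulus. *)
Lemma compact2_in_strip (K : R2 -> Prop) : compact2 K ->
  exists M, forall p, in_piK K p -> strip M p.
Proof.
  intros HK. destruct (compact2_bounded K (fun p => Rabs (snd p)) HK) as [M HM].
  - intros p e He; exists e; split; [exact He|]; intros q Hq.
    apply Rabs_Rabs_minus_lt, (proj2 (proj1 (dist2_lt p q e) Hq)).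
  - exists M; intros p [k Hk]. apply (HM _ Hk).
Qed.

Lemma in_piK_rect (M : R) (p : R2) : strip M p -> in_piK (rect 0 1 (- M) M) p.
Proof.
  intros Hp. exists (Int_part (fst p)). split; simpl.
  - destruct (base_Int_part (fst p)); lra.
  - apply Rabs_le_between; exact Hp.
Qed.

(* Lifts to the plane of homeomorphisms of the annulus acting trivially on its
   fundamental group; the ends may be exchanged. *)
Definition annulus_lift (h g : R2 -> R2) : Prop :=
  cont2 h /\ cont2 g /\ (forall p, g (h p) = p) /\ (forall p, h (g p) = p) /\
  (forall p, h (translate 1 p) = translate 1 (h p)).

Lemma annulus_lift_inv (h g : R2 -> R2) : annulus_lift h g -> annulus_lift g h.
Proof.
  intros [Hh [Hg [Hgh [Hhg HT]]]]. repeat split; auto.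
  intros p. rewrite <- (Hhg p) at 1. rewrite <- HT, Hgh. reflexivity.
Qed.

Lemma annulus_lift_comp (h g h' g' : R2 -> R2) : annulus_lift h g -> annulus_lift h' g' ->
  annulus_lift (fun p => h (h' p)) (fun p => g' (g p)).
Proof.
  assert (Hc : forall u v, cont2 u -> cont2 v -> cont2 (fun p => u (v p))).
  { intros u v Hu Hv p e He. destruct (Hu (v p) e He) as [d [Hd H]].
    destruct (Hv p d Hd) as [d' [Hd' H']]. exists d'; split; auto. }
  intros [Hh [Hg [Hgh [Hhg HT]]]] [Hh' [Hg' [Hgh' [Hhg' HT']]]].
  repeat split; auto; intros p.
  - rewrite Hgh; auto.
  - rewrite Hhg'; auto.
  - rewrite HT'; auto.
Qed.

Lemma annulus_lift_id : annulus_lift (fun p => p) (fun p => p).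
Proof. repeat split; auto; intros p e He; exists e; auto. Qed.

Lemma annulus_lift_iter (h g : R2 -> R2) (n : nat) : annulus_lift h g ->
  exists g', annulus_lift (Nat.iter n h) g'.
Proof.
  intros H; induction n as [|n [g' IH]].
  - exists (fun p => p); exact annulus_lift_id.
  - exists (fun p => g' (g p)). exact (annulus_lift_comp h g _ g' H IH).
Qed.

Lemma annulus_lift_shiftZ (h g : R2 -> R2) (k : Z) (p : R2) : annulus_lift h g ->
  h (translate (IZR k) p) = translate (IZR k) (h p).
Proof.
  intros [_ [_ [_ [_ HT]]]]. revert p.
  assert (H0 : forall p, translate 0 p = p).
  { intros [x y]; unfold translate; simpl; f_equal; ring. }
  assert (HS : forall a b p, translate (a + b) p = translate a (translate b p)).
  { intros a b [x y]; unfold translate; simpl; f_equal; ring. }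
  induction k as [|k IH|k IH] using Z.peano_ind; intros p.
  - rewrite !H0; reflexivity.
  - rewrite succ_IZR, !HS, IH, HT; reflexivity.
  - replace (IZR k) with (IZR (Z.pred k) + 1) in IH
      by (rewrite <- succ_IZR; f_equal; lia).
    specialize (IH (translate (Ropp 1) p)). rewrite !HS, <- HT in IH.
    rewrite <- (HS 1), Rplus_opp_r, H0 in IH. exact IH.
Qed.

(** Height of the image and horizontal displacement are invariant under deck translations, so a
    bound on a compact fundamental rectangle of the strip suffices. *)
Lemma annulus_lift_strip_bound (h g : R2 -> R2) (M : R) : annulus_lift h g ->
  exists B, forall p, strip M p -> strip B (h p) /\ Rabs (fst (h p) - fst p) <= B.
Proof.
  intros Hh.
  destruct (compact2_bounded (rect 0 1 (- M) M)
     (fun p => Rabs (snd (h p)) + Rabs (fst (h p) - fst p))) as [B HB].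
  - apply rect_compact.
  - intros p e He. destruct (cont2_fst_snd h (proj1 Hh) p (e / 3)) as [d [Hd H]]; [lra|].
    exists (Rmin d (e / 3)); split; [apply Rmin_pos; lra|]. intros q Hq.
    assert (Hqd : dist2 p q < d) by (eapply Rlt_le_trans; [exact Hq|apply Rmin_l]).
    assert (Hqe : dist2 p q < e / 3) by (eapply Rlt_le_trans; [exact Hq|apply Rmin_r]).
    destruct (H q Hqd) as [H1 H2]. apply dist2_lt in Hqe; destruct Hqe as [H3 _].
    apply Rabs_Rabs_minus_lt in H2.
    assert (H4 : Rabs ((fst (h p) - fst p) - (fst (h q) - fst q)) < 2 * e / 3).
    { apply Rabs_def2 in H1, H3. apply Rabs_def1; lra. }
    apply Rabs_Rabs_minus_lt in H4.
    apply Rabs_def2 in H2, H4. apply Rabs_def1; lra.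
  - exists B; intros p Hp. destruct (in_piK_rect M p Hp) as [k Hk].
    specialize (HB _ Hk).
    replace (fst p - IZR k, snd p) with (translate (IZR (- k)) p) in HB
      by (unfold translate; rewrite opp_IZR; reflexivity).
    rewrite (annulus_lift_shiftZ h g) in HB by exact Hh.
    unfold translate in HB; simpl in HB.
    replace (fst (h p) + IZR (- k) - (fst p + IZR (- k))) with (fst (h p) - fst p) in HB by ring.
    pose proof (Rabs_pos (snd (h p))). pose proof (Rabs_pos (fst (h p) - fst p)).
    unfold strip; lra.
Qed.

Definition segment (p q : R2) (t : R) : R2 :=
  (fst p + t * (fst q - fst p), snd p + t * (snd q - snd p)).

Lemma segment_snd_between (p q : R2) (t : R) : 0 <= t <= 1 ->
  Rmin (snd p) (snd q) <= snd (segment p q t) <= Rmax (snd p) (snd q).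
Proof.
  intros Ht; simpl. unfold Rmin, Rmax.
  destruct (Rle_dec (snd p) (snd q)); split; nra.
Qed.

Lemma segment_0 (p q : R2) : segment p q 0 = p.
Proof. destruct p; unfold segment; simpl; f_equal; ring. Qed.

Lemma segment_1 (p q : R2) : segment p q 1 = q.
Proof. destruct q; unfold segment; simpl; f_equal; ring. Qed.

Lemma segment_cont (h : R2 -> R2) (p q : R2) : cont2 h ->
  continuity (fun t => fst (h (segment p q t))) /\
  continuity (fun t => snd (h (segment p q t))).
Proof.
  intros Hh.
  set (L := Rabs (fst q - fst p) + Rabs (snd q - snd p) + 1).
  assert (HL : 0 < L /\ Rabs (fst q - fst p) <= L /\ Rabs (snd q - snd p) <= L).
  { pose proof (Rabs_pos (fst q - fst p)). pose proof (Rabs_pos (snd q - snd p)).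
    unfold L; repeat split; lra. }
  assert (Hd : forall t e, 0 < e -> exists d : posreal, forall s, Rabs (s - t) < d ->
     dist2 (h (segment p q t)) (h (segment p q s)) < e).
  { intros t e He. destruct (Hh (segment p q t) e He) as [d [Hd H]].
    assert (HdL : 0 < d / L) by (apply Rdiv_lt_0_compat; lra).
    exists (mkposreal _ HdL); simpl; intros s Hs. apply H, dist2_lt; simpl.
    assert (Hsd : Rabs (s - t) * L < d).
    { apply Rmult_lt_compat_r with (r := L) in Hs; [|lra].
      replace (d / L * L) with d in Hs by (field; lra). exact Hs. }
    pose proof (Rabs_pos (s - t)).
    split.
    - replace (fst p + t * (fst q - fst p) - (fst p + s * (fst q - fst p)))
        with (- ((s - t) * (fst q - fst p))) by ring.
      rewrite Rabs_Ropp, Rabs_mult. nra.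
    - replace (snd p + t * (snd q - snd p) - (snd p + s * (snd q - snd p)))
        with (- ((s - t) * (snd q - snd p))) by ring.
      rewrite Rabs_Ropp, Rabs_mult. nra. }
  split; intros t; apply continuity_pt_locally; intros e;
    destruct (Hd t e (cond_pos e)) as [d H]; exists d; intros s Hs;
    specialize (H s Hs); apply dist2_lt in H; rewrite Rabs_minus_sym; apply H.
Qed.

(** The image of a segment in [C] is connected and avoids the strip, so it cannot change sides. *)
Lemma convex_same_side (h : R2 -> R2) (C : R2 -> Prop) (M : R) :
  cont2 h -> 0 <= M ->
  (forall p q t, C p -> C q -> 0 <= t <= 1 -> C (segment p q t)) ->
  (forall p, C p -> ~ strip M (h p)) ->
  (forall p, C p -> M < snd (h p)) \/ (forall p, C p -> snd (h p) < - M).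
Proof.
  intros Hh HM Hconv Hout.
  assert (Hside : forall p, C p -> M < snd (h p) \/ snd (h p) < - M).
  { intros p Hp. apply NNPP; intros Hn. apply (Hout p Hp), Rabs_le_between; lra. }
  destruct (classic (exists p, C p /\ M < snd (h p))) as [[p [Hp Hpos]]|Hn].
  - left; intros q Hq.
    assert (0 < snd (h q)); [|destruct (Hside q Hq); lra].
    pose proof (continuous_no_zero_sign (fun t => snd (h (segment p q t))) 0 1
      (proj2 (segment_cont h p q Hh)) ltac:(lra)) as H.
    cbv beta in H. rewrite segment_0, segment_1 in H.
    apply H; [|lra]. intros t Ht E.
    destruct (Hside _ (Hconv p q t Hp Hq Ht)); lra.
  - right; intros q Hq. destruct (Hside q Hq); [|assumption].
    exfalso; apply Hn; exists q; auto.
Qed.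

(** For a lift of an annulus homeomorphism: its extension to the two-point end compactification
    fixes both ends. *)
Definition preserves_ends (h : R2 -> R2) : Prop :=
  forall M, exists B, forall p,
    (B < snd p -> M < snd (h p)) /\ (snd p < - B -> snd (h p) < - M).

Definition exchanges_ends (h : R2 -> R2) : Prop :=
  forall M, exists B, forall p,
    (B < snd p -> snd (h p) < - M) /\ (snd p < - B -> M < snd (h p)).

(** The preimage of the strip lies in a strip of half-width [B], so each half plane beyond [B] is
    mapped to one side of the strip. Both cannot go to the same side, since [h] is onto. *)
Lemma annulus_lift_ends_at (h g : R2 -> R2) (M : R) : annulus_lift h g -> 0 <= M ->
  exists B,
    (forall p, (B < snd p -> M < snd (h p)) /\ (snd p < - B -> snd (h p) < - M)) \/
    (forall p, (B < snd p -> snd (h p) < - M) /\ (snd p < - B -> M < snd (h p))).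
Proof.
  intros Hh HM.
  destruct (annulus_lift_strip_bound g h M (annulus_lift_inv _ _ Hh)) as [B HB].
  pose proof Hh as [Hc [Hcg [Hgh [Hhg HT]]]].
  assert (Hout : forall p, B < Rabs (snd p) -> ~ strip M (h p)).
  { intros p Hp Hs. apply HB in Hs. rewrite Hgh in Hs. unfold strip in Hs; lra. }
  destruct (annulus_lift_strip_bound h g B Hh) as [B' HB'].
  exists B.
  destruct (convex_same_side h (fun p => B < snd p) M Hc HM) as [U|U].
  { intros p q t Hp Hq Ht. pose proof (segment_snd_between p q t Ht) as H.
      revert H; unfold Rmin, Rmax; destruct (Rle_dec (snd p) (snd q)); lra. }
  { intros p Hp; apply Hout. pose proof (Rle_abs (snd p)); lra. }
  - destruct (convex_same_side h (fun p => snd p < - B) M Hc HM) as [L|L].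
    { intros p q t Hp Hq Ht. pose proof (segment_snd_between p q t Ht) as H.
      revert H; unfold Rmin, Rmax; destruct (Rle_dec (snd p) (snd q)); lra. }
    { intros p Hp; apply Hout. pose proof (Rle_abs (- snd p)). rewrite Rabs_Ropp in *; lra. }
    (* The point [(0, y)] lies below the image of the strip of half-width [B], hence would have no
       preimage. *)
    + exfalso. set (y := - (Rabs B' + 1)). pose proof (Rle_abs B'). pose proof (Rabs_pos B').
      destruct (Rlt_dec B (snd (g (0, y)))) as [H1|H1].
      { apply U in H1. rewrite Hhg in H1; simpl in H1; unfold y in H1; lra. }
      destruct (Rlt_dec (snd (g (0, y))) (- B)) as [H2|H2].
      { apply L in H2. rewrite Hhg in H2; simpl in H2; unfold y in H2; lra. }
      destruct (HB' (g (0, y))) as [H3 _].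
      { apply Rabs_le_between; lra. }
      rewrite Hhg in H3. apply Rabs_le_between in H3; simpl in H3; unfold y in H3; lra.
    + left; intros p; split; auto.
  - destruct (convex_same_side h (fun p => snd p < - B) M Hc HM) as [L|L].
    { intros p q t Hp Hq Ht. pose proof (segment_snd_between p q t Ht) as H.
      revert H; unfold Rmin, Rmax; destruct (Rle_dec (snd p) (snd q)); lra. }
    { intros p Hp; apply Hout. pose proof (Rle_abs (- snd p)). rewrite Rabs_Ropp in *; lra. }
    + right; intros p; split; auto.
    + exfalso. set (y := Rabs B' + 1). pose proof (Rle_abs B'). pose proof (Rabs_pos B').
      destruct (Rlt_dec B (snd (g (0, y)))) as [H1|H1].
      { apply U in H1. rewrite Hhg in H1; simpl in H1; unfold y in H1; lra. }
      destruct (Rlt_dec (snd (g (0, y))) (- B)) as [H2|H2].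
      { apply L in H2. rewrite Hhg in H2; simpl in H2; unfold y in H2; lra. }
      destruct (HB' (g (0, y))) as [H3 _].
      { apply Rabs_le_between; lra. }
      rewrite Hhg in H3. apply Rabs_le_between in H3; simpl in H3; unfold y in H3; lra.
Qed.

(** The alternative found at level [Rabs M] agrees with the one at level 0: one sufficiently high
    point [(0, y)] decides both. *)
Lemma annulus_lift_ends (h g : R2 -> R2) : annulus_lift h g ->
  preserves_ends h \/ exchanges_ends h.
Proof.
  intros Hh.
  destruct (annulus_lift_ends_at h g 0 Hh (Rle_refl 0)) as [B0 [H0|H0]]; [left|right];
    intros M; destruct (annulus_lift_ends_at h g (Rabs M) Hh (Rabs_pos M)) as [B [H|H]];
    exists B; pose proof (Rle_abs M); pose proof (Rabs_pos M);
    set (y := Rmax B0 B + 1);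
    pose proof (Rmax_l B0 B); pose proof (Rmax_r B0 B);
    pose proof (proj1 (H0 (0, y)) ltac:(simpl; unfold y; lra));
    pose proof (proj1 (H (0, y)) ltac:(simpl; unfold y; lra));
    try lra; intros p; destruct (H p) as [Hu Hl]; split; intros Hp;
    solve [apply Hu in Hp; lra | apply Hl in Hp; lra].
Qed.

Lemma preserves_ends_comp (h k : R2 -> R2) :
  preserves_ends h -> preserves_ends k -> preserves_ends (fun p => h (k p)).
Proof.
  intros Hh Hk M. destruct (Hh M) as [B HB]. destruct (Hk B) as [B' HB'].
  exists B'; intros p; split; intros Hp; apply HB, HB', Hp.
Qed.

Lemma preserves_ends_sqr (h g : R2 -> R2) : annulus_lift h g ->
  preserves_ends (fun p => h (h p)).
Proof.
  intros Hh; destruct (annulus_lift_ends h g Hh) as [H|H].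
  - apply preserves_ends_comp; exact H.
  - intros M. destruct (H M) as [B HB]. destruct (H B) as [B' HB'].
    exists B'; intros p; split; intros Hp; apply HB, HB', Hp.
Qed.

Lemma preserves_ends_iter (h : R2 -> R2) (n : nat) :
  preserves_ends h -> preserves_ends (Nat.iter n h).
Proof.
  intros Hh; induction n as [|n IH].
  - intros M; exists M; auto.
  - exact (preserves_ends_comp h (Nat.iter n h) Hh IH).
Qed.

(** * Return times to a strip *)

(** The half plane contains the strip, so that for [0 <= M] the property passes to compositions. *)
Definition moves_up (M : R) (h : R2 -> R2) : Prop :=
  forall p, - M <= snd p -> M < snd (h p).

Definition moves_down (M : R) (h : R2 -> R2) : Prop :=
  forall p, snd p <= M -> snd (h p) < - M.

(** If the strip goes above itself, its image misses the half plane below height [M], so [g] maps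
    that half plane to one side of the strip. As the ends are preserved, this is the lower side, and
    nothing from [- M] upwards lands at height at most [M]. *)
Lemma strip_disjoint_moves (h g : R2 -> R2) (M : R) :
  annulus_lift h g -> preserves_ends h -> 0 <= M ->
  (forall p, strip M p -> ~ strip M (h p)) -> moves_up M h \/ moves_down M h.
Proof.
  intros [Hc [Hcg [Hgh [Hhg HT]]]] He HM Hdis.
  destruct (He M) as [B HB].
  set (y := Rmax B M + 1). pose proof (Rmax_l B M). pose proof (Rmax_r B M).
  assert (Hdis' : forall C : R2 -> Prop,
    (forall p, C p -> ~ (exists q, strip M q /\ h q = p)) -> forall p, C p -> ~ strip M (g p)).
  { intros C HC p Hp Hs. apply (HC p Hp); exists (g p); auto. }
  destruct (convex_same_side h (strip M) M Hc HM) as [U|D]; auto.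
  { intros p q t Hp Hq Ht; unfold strip in *.
    apply Rabs_le_between in Hp, Hq. apply Rabs_le_between.
    pose proof (segment_snd_between p q t Ht) as H'.
    revert H'; unfold Rmin, Rmax; destruct (Rle_dec (snd p) (snd q)); lra. }
  - left. destruct (convex_same_side g (fun p => snd p <= M) M Hcg HM) as [L|L].
    + intros p q t Hp Hq Ht. pose proof (segment_snd_between p q t Ht) as H'.
      revert H'; unfold Rmin, Rmax; destruct (Rle_dec (snd p) (snd q)); lra.
    + apply Hdis'. intros p Hp [q [Hq E]]. apply U in Hq. rewrite E in Hq; lra.
    + exfalso. pose proof (proj2 (HB (0, - y)) ltac:(simpl; unfold y; lra)).
      specialize (L (h (0, - y)) ltac:(lra)). rewrite Hgh in L; simpl in L; unfold y in L; lra.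
    + intros p Hp. apply Rnot_le_lt; intros Hn. apply L in Hn. rewrite Hgh in Hn; lra.
  - right. destruct (convex_same_side g (fun p => - M <= snd p) M Hcg HM) as [L|L].
    + intros p q t Hp Hq Ht. pose proof (segment_snd_between p q t Ht) as H'.
      revert H'; unfold Rmin, Rmax; destruct (Rle_dec (snd p) (snd q)); lra.
    + apply Hdis'. intros p Hp [q [Hq E]]. apply D in Hq. rewrite E in Hq; lra.
    + intros p Hp. apply Rnot_le_lt; intros Hn. apply L in Hn. rewrite Hgh in Hn; lra.
    + exfalso. pose proof (proj1 (HB (0, y)) ltac:(simpl; unfold y; lra)).
      specialize (L (h (0, y)) ltac:(lra)). rewrite Hgh in L; simpl in L; unfold y in L; lra.
Qed.

Lemma iter_add_apply (h : R2 -> R2) (m n : nat) (p : R2) :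
  Nat.iter (m + n) h p = Nat.iter m h (Nat.iter n h p).
Proof. apply Nat.iter_add. Qed.

Lemma additive_multiple (A : nat -> Prop) (k m : nat) :
  (forall m n, A m -> A n -> A (m + n)%nat) -> A m -> A (S k * m)%nat.
Proof.
  intros HA Hm; induction k as [|k IH].
  - rewrite Nat.mul_1_l; exact Hm.
  - replace (S (S k) * m)%nat with (m + S k * m)%nat by lia. auto.
Qed.

(** With [l = q * j + r] and [r < j <= q], one has [l = (q - r) * j + r * S j], where [q - r] is
    positive. *)
Lemma two_consecutive_generate (A : nat -> Prop) (j : nat) :
  (forall m n, A m -> A n -> A (m + n)%nat) -> (1 <= j)%nat ->
  A j -> A (S j) -> forall l, (j * j <= l)%nat -> A l.
Proof.
  intros Hadd Hj Hj1 Hj2 l Hl.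
  assert (Hmul : forall k m, A m -> A (S k * m)%nat)
    by (intros; apply additive_multiple; auto).
  pose proof (Nat.div_mod_eq l j). pose proof (Nat.mod_upper_bound l j ltac:(lia)).
  assert (j <= l / j)%nat by (apply Nat.div_le_lower_bound; lia).
  set (q := (l / j)%nat) in *. set (r := (l mod j)%nat) in *.
  destruct r as [|r'] eqn:Er.
  - replace l with (S (q - 1) * j)%nat by nia. auto.
  - replace l with (S (q - S r' - 1) * j + S r' * S j)%nat by nia. auto.
Qed.

Definition returns (h : R2 -> R2) (M : R) (n : nat) (p : R2) : Prop :=
  strip M p /\ strip M (Nat.iter n h p).

Lemma return_times_gap (h g : R2 -> R2) (M : R) (j : nat) :
  annulus_lift h g -> preserves_ends h -> 0 <= M -> (1 <= j)%nat ->
  (forall m, exists n p, (m <= n)%nat /\ returns h M n p) ->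
  (exists p, returns h M j p) \/ (exists p, returns h M (S j) p).
Proof.
  intros Hh He HM Hj Hinf.
  apply NNPP; intros Hno.
  assert (Hm : forall k, (forall p, ~ returns h M k p) ->
     moves_up M (Nat.iter k h) \/ moves_down M (Nat.iter k h)).
  { intros k Hk. destruct (annulus_lift_iter h g k Hh) as [g' Hg'].
    apply (strip_disjoint_moves _ g' M Hg'); auto.
    - apply preserves_ends_iter, He.
    - intros p H1 H2; apply (Hk p); split; assumption. }
  assert (Hup : forall m n, moves_up M (Nat.iter m h) -> moves_up M (Nat.iter n h) ->
     moves_up M (Nat.iter (m + n) h)).
  { intros m n H1 H2 p Hp. rewrite iter_add_apply. apply H1. specialize (H2 p Hp); lra. }
  assert (Hdn : forall m n, moves_down M (Nat.iter m h) -> moves_down M (Nat.iter n h) ->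
     moves_down M (Nat.iter (m + n) h)).
  { intros m n H1 H2 p Hp. rewrite iter_add_apply. apply H1. specialize (H2 p Hp); lra. }
  assert (Hexcl : forall k, moves_up M (Nat.iter k h) -> moves_down M (Nat.iter k h) -> False).
  { intros k H1 H2. specialize (H1 (0, 0) ltac:(simpl; lra)).
    specialize (H2 (0, 0) ltac:(simpl; lra)). lra. }
  destruct (Hinf (j * j)%nat) as [l [p [Hl [Hp1 Hp2]]]].
  apply Rabs_le_between in Hp1, Hp2.
  destruct (Hm j) as [U1|D1]; [intros q Hq; apply Hno; eauto| |];
    (destruct (Hm (S j)) as [U2|D2]; [intros q Hq; apply Hno; eauto| |]).
  - pose proof (two_consecutive_generate (fun n => moves_up M (Nat.iter n h)) j
      Hup Hj U1 U2 l Hl p ltac:(lra)); lra.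
  - apply (Hexcl (S j * j)%nat).
    + apply (additive_multiple (fun n => moves_up M (Nat.iter n h)) j j Hup U1).
    + replace (S j * j)%nat with (S (j - 1) * S j)%nat by nia.
      apply (additive_multiple (fun n => moves_down M (Nat.iter n h)) _ _ Hdn D2).
  - apply (Hexcl (S j * j)%nat).
    + replace (S j * j)%nat with (S (j - 1) * S j)%nat by nia.
      apply (additive_multiple (fun n => moves_up M (Nat.iter n h)) _ _ Hup U2).
    + apply (additive_multiple (fun n => moves_down M (Nat.iter n h)) j j Hdn D1).
  - pose proof (two_consecutive_generate (fun n => moves_down M (Nat.iter n h)) j
      Hdn Hj D1 D2 l Hl p ltac:(lra)); lra.
Qed.

(* The image of a segment of horizontal extent less than 1 is disjoint from its
   translate, so it cannot jump over the window [k1, k2] outside the strip. *)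
Lemma segment_image_crossing (h g : R2 -> R2) (M k1 k2 : R) (p q : R2) :
  annulus_lift h g -> Rabs (fst q - fst p) < 1 -> k1 + 1 < k2 ->
  strip M (h p) -> strip M (h q) -> k1 <= fst (h p) -> fst (h q) <= k2 ->
  exists t, 0 <= t <= 1 /\ strip M (h (segment p q t)) /\
    k1 <= fst (h (segment p q t)) <= k2.
Proof.
  intros [Hc [_ [Hgh [_ HT]]]] Hpq Hk Hp Hq Hkp Hkq.
  destruct (segment_cont h p q Hc) as [HX HY].
  apply (strip_crossing (fun t => fst (h (segment p q t)))
           (fun t => snd (h (segment p q t))) M k1 k2 0 1 HX HY);
    rewrite ?segment_0, ?segment_1; auto; [lra|].
  intros s t Hs Ht E1 E2.
  assert (E : h (segment p q t) = h (translate 1 (segment p q s))).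
  { rewrite HT. unfold translate. rewrite <- E1, <- E2. apply surjective_pairing. }
  apply (f_equal g) in E. rewrite !Hgh in E. apply (f_equal fst) in E. simpl in E.
  assert (Hts : Rabs (t - s) <= 1) by (apply Rabs_le_between; lra).
  assert (E3 : Rabs (t - s) * Rabs (fst q - fst p) = 1).
  { rewrite <- Rabs_mult. replace ((t - s) * (fst q - fst p)) with 1 by lra. apply Rabs_R1. }
  pose proof (Rabs_pos (fst q - fst p)). nra.
Qed.

Definition disp (h : R2 -> R2) (n : nat) (p : R2) : R := fst (Nat.iter n h p) - fst p.

Lemma disp_add (h : R2 -> R2) (m n : nat) (p : R2) :
  disp h (m + n) p = disp h m (Nat.iter n h p) + disp h n p.
Proof. unfold disp. rewrite iter_add_apply. ring. Qed.

(** Induction on the distance [d] from a time in [A] to a later one in [B]: within two steps after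
    [i] there is another time of one kind. If it is in [B], the search ends; if in [A], it restarts
    from there. *)
Lemma sign_change (A B : nat -> Prop) :
  (forall j, (1 <= j)%nat -> (A j \/ B j) \/ (A (S j) \/ B (S j))) ->
  forall d i, A i -> B (i + d)%nat ->
  exists n r, (i <= n)%nat /\ (r <= 2)%nat /\ A n /\ B (r + n)%nat.
Proof.
  intros Hgap d; induction d as [d IH] using lt_wf_ind; intros i HA HB.
  destruct (Nat.le_gt_cases d 2) as [Hd|Hd].
  - exists i, d; repeat split; auto. rewrite Nat.add_comm; exact HB.
  - assert (Hrec : forall k, (1 <= k <= 2)%nat -> A (k + i)%nat ->
      exists n r, (i <= n)%nat /\ (r <= 2)%nat /\ A n /\ B (r + n)%nat).
    { intros k Hk HAk. destruct (IH (d - k)%nat ltac:(lia) (k + i)%nat HAk) as [n [r [Hn H]]].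
      - replace (k + i + (d - k))%nat with (i + d)%nat by lia; exact HB.
      - exists n, r; split; [lia|exact H]. }
    destruct (Hgap (1 + i)%nat ltac:(lia)) as [[H|H]|[H|H]].
    + apply (Hrec 1%nat); [lia|exact H].
    + exists i, 1%nat; repeat split; auto; lia.
    + apply (Hrec 2%nat); [lia|exact H].
    + exists i, 2%nat; repeat split; auto; lia.
Qed.

Lemma intermediate_displacement (h g : R2 -> R2) (M beta : R) :
  annulus_lift h g -> preserves_ends h -> 0 <= M ->
  (forall m, exists n p, (m <= n)%nat /\ returns h M n p /\ disp h n p <= beta * INR n) ->
  (forall m, exists n p, (m <= n)%nat /\ returns h M n p /\ beta * INR n <= disp h n p) ->
  exists M' C, forall m, exists n p, (m <= n)%nat /\ returns h M' n p /\
    Rabs (disp h n p - beta * INR n) <= C.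
Proof.
  intros Hh He HM Hlo Hhi.
  assert (Hb : forall r, exists B, forall p, strip M p ->
             strip B (Nat.iter r h p) /\ Rabs (disp h r p) <= B).
  { intros r. destruct (annulus_lift_iter h g r Hh) as [g' Hg'].
    exact (annulus_lift_strip_bound _ g' M Hg'). }
  destruct (Hb 0%nat) as [B0 HB0]. destruct (Hb 1%nat) as [B1 HB1].
  destruct (Hb 2%nat) as [B2 HB2].
  (* One bound for the iterates 0, 1 and 2, the possible differences between neighbouring return
     times. *)
  set (B := Rmax M (Rmax B0 (Rmax B1 B2))).
  assert (HB : M <= B /\ B0 <= B /\ B1 <= B /\ B2 <= B).
  { pose proof (Rmax_l M (Rmax B0 (Rmax B1 B2))). pose proof (Rmax_r M (Rmax B0 (Rmax B1 B2))).
    pose proof (Rmax_l B0 (Rmax B1 B2)). pose proof (Rmax_r B0 (Rmax B1 B2)).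
    pose proof (Rmax_l B1 B2). pose proof (Rmax_r B1 B2). unfold B.
    repeat split; lra. }
  assert (HBr : forall r p, (r <= 2)%nat -> strip M p ->
             strip B (Nat.iter r h p) /\ Rabs (disp h r p) <= B).
  { intros r p Hr Hp. unfold strip.
    destruct (HB0 p Hp); destruct (HB1 p Hp); destruct (HB2 p Hp); unfold strip in *.
    destruct r as [|[|[|r]]]; [split; lra..|lia]. }
  exists B, (B + 2 * Rabs beta + 3). intros m.
  set (low := fun n => exists p, returns h M n p /\ disp h n p <= beta * INR n).
  set (high := fun n => exists p, returns h M n p /\ beta * INR n <= disp h n p).
  assert (Hgap : forall j, (1 <= j)%nat -> (high j \/ low j) \/ (high (S j) \/ low (S j))).
  { assert (Hs : forall j, (exists p, returns h M j p) -> high j \/ low j).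
    { intros j [p Hp]. destruct (Rle_dec (beta * INR j) (disp h j p)); [left|right];
        exists p; split; auto; lra. }
    intros j Hj. destruct (return_times_gap h g M j Hh He HM Hj) as [H|H]; auto.
    intros k; destruct (Hlo k) as [n [p [? [? _]]]]; eauto. }
  (* The high time is chosen first and the low one after it, so the times found between them are at
     least [m]. *)
  destruct (Hhi m) as [i [p0 [Hi Hp0]]].
  destruct (Hlo i) as [i' [q0 [Hi' Hq0]]].
  destruct (sign_change high low Hgap (i' - i)%nat i) as [n [r [Hn [Hr [Hhigh Hlow]]]]].
  { exists p0; exact Hp0. }
  { replace (i + (i' - i))%nat with i' by lia. exists q0; exact Hq0. }
  clear p0 Hp0 q0 Hq0.
  destruct Hhigh as [p' [[Hp1 Hp2] Hp3]]. destruct Hlow as [q [[Hq1 Hq2] Hq3]].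
  set (N := (r + n)%nat) in *.
  destruct (annulus_lift_iter h g N Hh) as [gN HN].
  (* The integer translate [p] of [p'] lies less than 1 to the right of [q] horizontally, as the
     crossing lemma requires. *)
  set (k := (- Int_part (fst p' - fst q))%Z).
  set (p := translate (IZR k) p').
  assert (Ek : fst p = fst p' + IZR k) by reflexivity.
  assert (HpN : Nat.iter N h p = translate (IZR k) (Nat.iter N h p')).
  { apply (annulus_lift_shiftZ _ gN); exact HN. }
  assert (Hpq : 0 <= fst p - fst q < 1).
  { rewrite Ek. unfold k; rewrite opp_IZR.
    destruct (base_Int_part (fst p' - fst q)); lra. }
  (* Prolonging the high orbit by [r <= 2] steps to the common time [N] costs at most [B] in
     displacement and [2 * Rabs beta] in the comparison term. *)
  assert (HdN : disp h N p' >= beta * INR N - 2 * Rabs beta - B).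
  { unfold N. rewrite disp_add, plus_INR.
    destruct (HBr r _ Hr Hp2) as [_ Hd]. apply Rabs_le_between in Hd.
    assert (0 <= INR r <= 2).
    { split; [apply pos_INR|]. apply (le_INR r 2) in Hr; simpl in Hr; lra. }
    assert (beta * INR r <= 2 * Rabs beta).
    { pose proof (Rle_abs beta). pose proof (Rabs_pos beta). nra. }
    lra. }
  pose proof (Rabs_pos beta).
  (* The left end of the window is the lower bound for the image of [p]; the margin 2 at the right
     makes the window longer than 1. *)
  destruct (segment_image_crossing (Nat.iter N h) gN B
     (fst q + beta * INR N - 2 * Rabs beta - B) (fst q + beta * INR N + 2) p q HN)
     as [t [Ht [Hst Hxt]]].
  - apply Rabs_def1; lra.
  - lra.
  - rewrite HpN. unfold N; rewrite iter_add_apply. apply (HBr r _ Hr Hp2).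
  - unfold strip in *; lra.
  - rewrite HpN. unfold disp in HdN. simpl. lra.
  - unfold disp in Hq3; lra.
  - exists N, (segment p q t); split; [unfold N; lia|]; split; [split|].
    + unfold strip in *. apply Rabs_le_between in Hp1, Hq1. apply Rabs_le_between.
      assert (snd p = snd p') by reflexivity.
      pose proof (segment_snd_between p q t Ht) as H'.
      revert H'; unfold Rmin, Rmax; destruct (Rle_dec (snd p) (snd q)); lra.
    + exact Hst.
    + assert (Hseg : fst q <= fst (segment p q t) <= fst q + 1) by (simpl; nra).
      unfold disp. apply Rabs_le_between. lra.
Qed.

(** * The rotation set *)

Lemma iter_sqr (h : R2 -> R2) (i : nat) (p : R2) :
  Nat.iter i (fun x => h (h x)) p = Nat.iter (2 * i) h p.
Proof.
  induction i as [|i IH]; [reflexivity|].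
  replace (2 * S i)%nat with (S (S (2 * i))) by lia.
  simpl Nat.iter at 1. rewrite IH. reflexivity.
Qed.

(** The real [c] records a definite gap below [b], in a form common to finite and infinite [x]; this
    gap later absorbs bounded errors. *)
Lemma ER_cl_below (S : ER -> Prop) (x : ER) (b : R) :
  ER_cl S x -> ER_le x (Fin b) -> x <> Fin b ->
  exists c y, c < b /\ S y /\ ER_le y (Fin c).
Proof.
  intros Hx Hle Hne. destruct x as [a| |]; simpl in Hle; [|contradiction|].
  - assert (Hab : a < b) by (destruct Hle as [|E]; [assumption|subst; congruence]).
    destruct (Hx ((b - a) / 2) ltac:(lra)) as [y [Hy [s [-> Hs]]]].
    apply Rabs_def2 in Hs. exists ((a + b) / 2), (Fin s); simpl; repeat split; auto; lra.
  - destruct (Hx (b - 1) I) as [y [Hy [->|[s [-> Hs]]]]].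
    + exists (b - 1), MInf; simpl; repeat split; auto; lra.
    + exists (b - 1), (Fin s); simpl; repeat split; auto; lra.
Qed.

Lemma ER_cl_above (S : ER -> Prop) (x : ER) (b : R) :
  ER_cl S x -> ER_le (Fin b) x -> x <> Fin b ->
  exists c y, b < c /\ S y /\ ER_le (Fin c) y.
Proof.
  intros Hx Hle Hne. destruct x as [a| |]; simpl in Hle; [| |contradiction].
  - assert (Hab : b < a) by (destruct Hle as [|E]; [assumption|subst; congruence]).
    destruct (Hx ((a - b) / 2) ltac:(lra)) as [y [Hy [s [-> Hs]]]].
    apply Rabs_def2 in Hs. exists ((a + b) / 2), (Fin s); simpl; repeat split; auto; lra.
  - destruct (Hx (b + 1) I) as [y [Hy [->|[s [-> Hs]]]]].
    + exists (b + 1), PInf; simpl; repeat split; auto; lra.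
    + exists (b + 1), (Fin s); simpl; repeat split; auto; lra.
Qed.

Lemma rho_n_disp (F : R -> R2 -> R2) (n : nat) (p : R2) : (1 <= n)%nat ->
  disp (F 1) n p = rho_n F n p * INR n.
Proof.
  intros Hn. unfold rho_n, disp, fiter. field. apply not_0_INR; lia.
Qed.

Lemma rho_ann_below (F : R -> R2 -> R2) (x : ER) (b : R) :
  rho_ann F x -> ER_le x (Fin b) -> x <> Fin b ->
  exists M c, c < b /\ forall m, exists n p, (m <= n)%nat /\ returns (F 1) M n p /\
    disp (F 1) n p <= c * INR n.
Proof.
  intros Hx Hle Hne.
  destruct (ER_cl_below _ _ _ Hx Hle Hne) as [c [y [Hc [[K [HK Hy]] Hyc]]]].
  destruct (compact2_in_strip K HK) as [M HM].
  (* A second closure, that in [rho_K], is still to be undone; [c'] leaves room for it between [c]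
     and [b]. *)
  set (c' := (c + b) / 2).
  exists M, c'; split; [unfold c'; lra|]. intros m.
  destruct (ER_cl_below _ y c' (Hy (S m) ltac:(lia))) as [c'' [z [Hc'' [[n [p [Hn [Hp [Hp' ->]]]]] Hz]]]].
  - destruct y; simpl in *; auto; unfold c'; lra.
  - intros ->. simpl in Hyc. unfold c' in Hyc; lra.
  - simpl in Hz. exists n, p; split; [lia|]; split; [split; apply HM; assumption|].
    rewrite rho_n_disp by lia. apply Rmult_le_compat_r; [apply pos_INR|lra].
Qed.

Lemma rho_ann_above (F : R -> R2 -> R2) (x : ER) (b : R) :
  rho_ann F x -> ER_le (Fin b) x -> x <> Fin b ->
  exists M c, b < c /\ forall m, exists n p, (m <= n)%nat /\ returns (F 1) M n p /\
    c * INR n <= disp (F 1) n p.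
Proof.
  intros Hx Hle Hne.
  destruct (ER_cl_above _ _ _ Hx Hle Hne) as [c [y [Hc [[K [HK Hy]] Hyc]]]].
  destruct (compact2_in_strip K HK) as [M HM].
  set (c' := (c + b) / 2).
  exists M, c'; split; [unfold c'; lra|]. intros m.
  destruct (ER_cl_above _ y c' (Hy (S m) ltac:(lia))) as [c'' [z [Hc'' [[n [p [Hn [Hp [Hp' ->]]]]] Hz]]]].
  - destruct y; simpl in *; auto; unfold c'; lra.
  - intros ->. simpl in Hyc. unfold c' in Hyc; lra.
  - simpl in Hz. exists n, p; split; [lia|]; split; [split; apply HM; assumption|].
    rewrite rho_n_disp by lia. apply Rmult_le_compat_r; [apply pos_INR|lra].
Qed.

(* [e] is 1 or -1, to treat upper and lower bounds alike. *)
Lemma even_returns (h : R2 -> R2) (M M' e c b : R) :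
  M <= M' ->
  (forall p, strip M p -> strip M' (h p) /\ Rabs (fst (h p) - fst p) <= M') ->
  Rabs e <= 1 -> e * c < e * b ->
  (forall m, exists n p, (m <= n)%nat /\ returns h M n p /\ e * disp h n p <= e * c * INR n) ->
  forall m, exists i p, (m <= i)%nat /\ returns (fun x => h (h x)) M' i p /\
    e * disp (fun x => h (h x)) i p <= e * (2 * b) * INR i.
Proof.
  intros HMM HB He Hcb Hret m.
  (* For [n >= N] the gap between [c] and [b], multiplied by [n], exceeds the cost of one additional
     iterate. *)
  destruct (INR_unbounded ((M' + Rabs b) / (e * b - e * c))) as [N HN].
  destruct (Hret (2 * m + N)%nat) as [n [p [Hn [[Hp1 Hp2] Hd]]]].
  assert (HnN : M' + Rabs b <= (e * b - e * c) * INR n).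
  { assert (HNn : INR N <= INR n) by (apply le_INR; lia).
    replace (M' + Rabs b) with ((e * b - e * c) * ((M' + Rabs b) / (e * b - e * c))) by (field; lra).
    apply Rmult_le_compat_l; lra. }
  assert (HM' : 0 <= M') by (pose proof (Rabs_pos (snd p)); unfold strip in Hp1; lra).
  pose proof (Rabs_pos b).
  destruct (Nat.Even_or_Odd n) as [[i Ei]|[i Ei]].
  - exists i, p; split; [lia|]. unfold returns, disp in *. rewrite iter_sqr, <- Ei.
    repeat split; [unfold strip in *; lra..|].
    replace (e * (2 * b) * INR i) with (e * b * INR n)
      by (rewrite Ei, mult_INR; simpl; ring). lra.
  (* An odd time is made even by one more iterate, which stays in the larger strip of half-width
     [M']. *)
  - exists (S i), p; split; [lia|]. unfold returns, disp in *. rewrite iter_sqr.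
    replace (2 * S i)%nat with (1 + n)%nat by lia.
    rewrite iter_add_apply; simpl Nat.iter at 1 3.
    destruct (HB _ Hp2) as [Hs Hx].
    repeat split; [unfold strip in *; lra|exact Hs|].
    replace (e * (2 * b) * INR (S i)) with (e * b * INR n + e * b).
    2: { rewrite Ei, plus_INR, mult_INR, (S_INR i); simpl; ring. }
    assert (He1 : e * (fst (h (Nat.iter n h p)) - fst (Nat.iter n h p)) <= M').
    { eapply Rle_trans; [apply Rle_abs|]. rewrite Rabs_mult.
      pose proof (Rabs_pos e). pose proof (Rabs_pos (fst (h (Nat.iter n h p)) - fst (Nat.iter n h p))). nra. }
    assert (He2 : - (e * b) <= Rabs b).
    { eapply Rle_trans; [apply Rle_abs|]. rewrite Rabs_Ropp, Rabs_mult.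
      pose proof (Rabs_pos e). nra. }
    lra.
Qed.

Theorem theoremB (F : R -> R2 -> R2) (HF : isotopy_lift F) :
  ER_interval (rho_ann F).
Proof.
  intros a b c Ha Hc Hab Hbc.
  destruct (classic (a = b)) as [<-|Hne1]; [exact Ha|].
  destruct (classic (c = b)) as [<-|Hne2]; [exact Hc|].
  (* An infinite [b] between [a] and [c] would equal one of them, so [b] is real. *)
  destruct b as [b| |].
  2: { destruct c; simpl in Hbc; try contradiction; congruence. }
  2: { destruct a; simpl in Hab; try contradiction; congruence. }
  assert (Hh : exists g, annulus_lift (F 1) g).
  { destruct HF as [Hcont [_ [Hinv HT]]].
    destruct (Hinv 1 ltac:(lra)) as [g [Hg [H1 H2]]].
    exists g; repeat split; auto.
    - intros p e He. destruct (Hcont 1 p e ltac:(lra) He) as [d [Hd H]].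
      exists d; split; [exact Hd|]; intros q Hq. apply H; auto; [lra|].
      rewrite Rminus_diag, Rabs_R0; exact Hd.
    - intros [x y]; unfold translate; simpl. apply HT; lra. }
  destruct Hh as [g Hh].
  destruct (rho_ann_below F a b Ha Hab Hne1) as [M1 [c1 [Hc1 Hlo]]].
  destruct (rho_ann_above F c b Hc Hbc Hne2) as [M2 [c2 [Hc2 Hhi]]].
  set (M := Rmax M1 M2).
  assert (HM1 : M1 <= M) by apply Rmax_l. assert (HM2 : M2 <= M) by apply Rmax_r.
  destruct (annulus_lift_strip_bound (F 1) g M Hh) as [B HB].
  set (M' := Rmax (Rmax M B) 0).
  assert (HM' : M <= M' /\ B <= M' /\ 0 <= M').
  { pose proof (Rmax_l (Rmax M B) 0). pose proof (Rmax_r (Rmax M B) 0).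
    pose proof (Rmax_l M B). pose proof (Rmax_r M B). unfold M'; lra. }
  assert (HB' : forall p, strip M p -> strip M' (F 1 p) /\ Rabs (fst (F 1 p) - fst p) <= M').
  { intros p Hp. destruct (HB p Hp) as [H1 H2]; unfold strip in *; lra. }
  (* The square of the time-one map preserves the ends, and rotation number [b] becomes slope
     [2 * b]. *)
  destruct (intermediate_displacement (fun x => F 1 (F 1 x)) (fun x => g (g x)) M' (2 * b))
    as [M3 [C HC]].
  - exact (annulus_lift_comp _ _ _ _ Hh Hh).
  - exact (preserves_ends_sqr _ _ Hh).
  - lra.
  - intros m. destruct (even_returns (F 1) M M' 1 c1 b) with (m := m)
      as [i [p [Hi [Hr Hd]]]]; auto; try lra.
    + rewrite Rabs_R1; lra.
    + intros k. destruct (Hlo k) as [n [p [Hn [[Hp1 Hp2] Hd]]]].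
      exists n, p. unfold returns, strip in *. repeat split; auto; lra.
    + exists i, p; repeat split; try apply Hr; auto; lra.
  - intros m. destruct (even_returns (F 1) M M' (-1) c2 b) with (m := m)
      as [i [p [Hi [Hr Hd]]]]; auto; try lra.
    + rewrite Rabs_left; lra.
    + intros k. destruct (Hhi k) as [n [p [Hn [[Hp1 Hp2] Hd]]]].
      exists n, p. unfold returns, strip in *. repeat split; auto; lra.
    + exists i, p; repeat split; try apply Hr; auto; lra.
  - intros r Hr. exists (Fin b); split.
    2: { exists b; split; [reflexivity|]. rewrite Rminus_diag, Rabs_R0; exact Hr. }
    (* The number [b] already belongs to [rho_K] for this single rectangle. *)
    exists (rect 0 1 (- M3) M3); split; [apply rect_compact|].
    clear r Hr. intros m Hm r Hr.
    (* At time [2 * i] the error in the mean displacement is at most [C / (2 * i)], which is below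
       [r] once [i >= N]. *)
    destruct (INR_unbounded (C / r)) as [N HN].
    destruct (HC (m + N)%nat) as [i [p [Hi [[Hp1 Hp2] Hd]]]].
    rewrite iter_sqr in Hp2.
    exists (Fin (rho_n F (2 * i) p)); split.
    + exists (2 * i)%nat, p; repeat split; try apply in_piK_rect; auto; lia.
    + exists (rho_n F (2 * i) p); split; [reflexivity|].
      assert (Hdisp : disp (fun x => F 1 (F 1 x)) i p = rho_n F (2 * i) p * (2 * INR i)).
      { transitivity (disp (F 1) (2 * i) p).
        - unfold disp; rewrite iter_sqr; reflexivity.
        - rewrite rho_n_disp by lia. rewrite mult_INR; reflexivity. }
      rewrite Hdisp in Hd.
      replace (rho_n F (2 * i) p * (2 * INR i) - 2 * b * INR i)
        with ((rho_n F (2 * i) p - b) * (2 * INR i)) in Hd by ring.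
      assert (HiN : INR N <= INR i) by (apply le_INR; lia).
      assert (Hi0 : 0 < INR i) by (apply lt_0_INR; lia).
      rewrite Rabs_mult, (Rabs_right (2 * INR i)) in Hd by lra.
      assert (HCr : C < INR i * r).
      { replace C with (C / r * r) by (field; lra). apply Rmult_lt_compat_r; lra. }
      apply Rmult_lt_reg_r with (2 * INR i); [lra|]. nra.
Qed.
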